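(* Let $H$ be a separable infinite-dimensional complex Hilbert space, and let $L$ be a normal linear operator (either unbounded in $H$ or bounded on $H$) with pure point spectrum, i.e. $H$ has an orthonormal basis $(e_j)_{j=1}^\infty$ formed by eigenvectors of $L$. Let $N$ be a normed space such that $N$ and $H$ are embedded algebraically in a certain linear space. Let $\omega,\eta:\mathrm{Spec}\,L\to\mathbb{C}\setminus\{0\}$ be Borel measurable bounded functions, and consider the bounded linear operators $R:=\omega(L)$ and $S:=\eta(L)$ on $H$. Assume that $R$ is a bounded operator from $H$ to $N$. Then the series $f=\sum_{j=1}^\infty(f,e_j)e_j$ converges unconditionally (i.e. under each permutation of its terms) in the space $N$ at every vector $f\in RS(H)$. Moreover, the degree of this convergence admits the estimate $$\Bigl\|f-\sum_{j=1}^k(f,e_j)e_j\Bigr\|_N\le\|R\|_{H\to N}\cdot\|g\|\cdot\|S(I-P_k)\|_{H\to H}\cdot r_{g,k}$$ for every integer $k\ge1$ and with some decreasing sequence $(r_{g,k})_{k=1}^\infty\subset[0,1]$ that tends to zero and does not depend on $S$ and $R$. Here, $g:=(RS)^{-1}f\in H$.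
   Context: $(\cdot,\cdot)$ and $\|\cdot\|$ are the inner product and norm in $H$; $I$ is the identity operator on $H$; $P_k$ is the orthogonal projector of $H$ onto the linear span of $e_1,\dots,e_k$; $\|\cdot\|_{H\to N}$ and $\|\cdot\|_{H\to H}$ are operator norms. ''Decreasing'' is understood as non-increasing. The operator $RS=(\omega\eta)(L)$ is injective, so $(RS)^{-1}f$ is well defined for $f\in RS(H)$. ''Converges in $N$ at $f$'' means that the partial sums belong to $N$ and converge to $f$ in the norm of $N$. *)

(* Defs.v *)
From HB Require Import structures.
From mathcomp Require Import all_boot all_order all_algebra.
From mathcomp Require Import all_classical all_reals all_analysis.
From mathcomp Require Export complex.

Set Implicit Arguments.
Unset Strict Implicit.
Unset Printing Implicit Defensive.

Import Order.TTheory GRing.Theory Num.Theory.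
Import numFieldNormedType.Exports.

Local Open Scope classical_set_scope.
Local Open Scope ring_scope.

(* Norms over R[i] take their values in R[i]; this is the real-valued norm. *)
Definition rnorm (R : realType) (V : normedZmodType R[i]) (x : V) : R :=
  complex.Re `|x|.

Definition opnorm (R : realType) (U V : normedZmodType R[i]) (T : U -> V) : R :=
  sup [set rnorm (T x) | x in [set x | rnorm x <= 1]].

Definition separable_space (T : topologicalType) : Prop :=
  exists D : set T, countable D /\ dense D.

Definition infinite_dimensional (K : fieldType) (V : lmodType K) : Prop :=
  ~ exists n (v : 'I_n -> V),
      forall x, exists c : 'I_n -> K, x = \sum_(j < n) c j *: v j.

Section Hilbert.
Context (R : realType) (H : completeNormedModType R[i]).
Variable ip : {dot H for Num.conj}.

(* [ip] is linear in its first argument, conjugate-linear in the second. *)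
Definition norm_of_dot : Prop := forall x : H, `|x| ^+ 2 = ip x x.

Definition lin_span (e : nat -> H) (k : nat) : set H :=
  [set v | exists c : 'I_k -> R[i], v = \sum_(j < k) c j *: e j].

Definition orthonormal_basis (e : nat -> H) : Prop :=
  (forall i j, ip (e i) (e j) = (i == j)%:R) /\
  dense (\bigcup_k lin_span e k).

Definition orth_projector (V : set H) (P : H -> H) : Prop :=
  forall x, V (P x) /\ forall v, V v -> ip (x - P x) v = 0.

(* Possibly unbounded: the values of [app] outside [dom] are irrelevant. *)
Record operator : Type := Operator {
  dom : set H ;
  app :> H -> H ;
  dom0 : dom 0 ;
  dom_linear : forall (a : R[i]) x y, dom x -> dom y -> dom (a *: x + y) ;
  app_linear : forall (a : R[i]) x y, dom x -> dom y ->
    app (a *: x + y) = a *: app x + app y }.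

Definition total_operator (T : {linear H -> H}) : operator :=
  @Operator setT T I (fun _ _ _ _ _ => I) (fun a x y _ _ => linearP T a x y).

(* (y, z) belongs to the graph of the adjoint of L. *)
Definition adjoint_graph (L : operator) (y z : H) : Prop :=
  forall x, dom L x -> ip (L x) y = ip x z.

(* The last clause is the equality L* L = L L* of unbounded operators, natural
   domains included. *)
Definition normal_operator (L : operator) : Prop :=
  [/\ dense (dom L),
      closed [set p : H * H | dom L p.1 /\ p.2 = L p.1] &
      forall x z, (dom L x /\ adjoint_graph L (L x) z) <->
        exists y, [/\ adjoint_graph L x y, dom L y & z = L y]].

Definition resolvent_set (L : operator) : set R[i] :=
  [set z | exists B : {linear H -> H},
     [/\ continuous B,
         forall y, dom L (B y) /\ L (B y) - z *: B y = y &
         forall x, dom L x -> B (L x - z *: x) = x]].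

Definition spectrum (L : operator) : set R[i] := ~` resolvent_set L.

Definition eigenvector (L : operator) (v : H) : Prop :=
  [/\ v != 0, dom L v & exists a : R[i], L v = a *: v].

Definition borelC : Type := g_sigma_algebraType (@open R[i]^o).

(* Projection-valued measure on the Borel sets of the complex plane; [diag f]
   is the measure A |-> (E(A) f, f), so its type is the countable additivity. *)
Record spectral_measure : Type := SpectralMeasure {
  proj :> set borelC -> {linear H -> H} ;
  diag : H -> {measure set borelC -> \bar R} ;
  proj_selfadjoint : forall A, measurable A ->
    forall x y, ip (proj A x) y = ip x (proj A y) ;
  projI : forall A B, measurable A -> measurable B ->
    forall x, proj (A `&` B) x = proj A (proj B x) ;
  projT : forall x, proj setT x = x ;
  diagE : forall f A, measurable A -> diag f A = (complex.Re (ip (proj A f) f))%:E }.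

Definition cintegral (mu : {measure set borelC -> \bar R}) (D : set borelC)
    (g : borelC -> R[i]) : R[i] :=
  Complex (\int[mu]_(z in D) complex.Re (g z))
          (\int[mu]_(z in D) complex.Im (g z)).

(* T = \int_D g dE: the domain of T consists of all f such that
   \int_D |g|^2 d(E f, f) < oo, and (T f, f) = \int_D g d(E f, f) there. *)
Definition spectral_integral (E : spectral_measure) (D : set borelC)
    (g : borelC -> R[i]) (T : operator) : Prop :=
  dom T = [set f | (\int[diag E f]_(z in D) (rnorm (g z) ^+ 2)%:E < +oo)%E] /\
  forall f, dom T f -> ip (T f) f = cintegral (diag E f) D g.

Definition spectral_resolution (L : operator) (E : spectral_measure) : Prop :=
  (forall x, E (spectrum L) x = x) /\
  spectral_integral E (spectrum L) (fun z => z) L.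

(* T = phi(L). *)
Definition borel_calculus (L : operator) (phi : borelC -> R[i])
    (T : {linear H -> H}) : Prop :=
  exists E, spectral_resolution L E /\
    spectral_integral E (spectrum L) phi (total_operator T).

(* Bounded Borel functions Spec L -> C \ {0}; values off Spec L are
   irrelevant. *)
Definition bounded_borel_symbol (L : operator) (phi : borelC -> borelC) : Prop :=
  [/\ measurable_fun (spectrum L : set borelC) phi,
      exists M : R, forall z, spectrum L z -> rnorm (phi z : R[i]) <= M &
      forall z, spectrum L z -> phi z <> (0 : R[i])].

Definition fourier_sum (e : nat -> H) (f : H) (k : nat) : H :=
  \sum_(j < k) ip f (e j) *: e j.

End Hilbert.

(* H and N are regarded as subspaces of X through the embeddings iH, iN: the
   vectors u_n lie in N and converge to f in N. *)
Definition converges_in (R : realType) (H N : normedModType R[i])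
    (X : lmodType R[i]) (iH : {linear H -> X}) (iN : {linear N -> X})
    (u : nat -> H) (f : H) : Prop :=
  exists (v : nat -> N) (y : N),
    [/\ forall n, iN (v n) = iH (u n), iN y = iH f & v @ \oo --> y].

(* Main.v *)
Require Import Defs.
From HB Require Import structures.
From mathcomp Require Import all_boot all_order all_algebra.
From mathcomp Require Import all_classical all_reals all_analysis.
From mathcomp Require Import measurable_realfun ring lra.

(** Each e_j is an eigenvector of R and S and of their adjoints, hence R, S
    and P_k commute.  With h = g - P_k g this gives
      f - P_k f = R S (g - P_k g) = R (S (I - P_k)) h,
    and one may take r_{g,k} = |g - P_k g| / |g|, which does not involve R and S.
    Unconditional convergence in N is that of the orthogonal series of g in H,
    transported by the continuous operator R S : H -> N.

    The eigenvector property has to be read off the quadratic forms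
    (T f, f) = \int phi d(E f, f).  The unitaries E(A) + c E(~A), |c| = 1, preserve
    all measures (E f, f), so by polarization (T E(A) f, E(~A) f) = 0.  Applied to
    L e = a e, this shows that on u = E(A) e the mean of z over (E u, u) is a; when
    A is an open half-plane with a on its boundary this forces u = 0, hence
    E({a}) e = e.  On the range of E({a}) the form (T f, f) is phi(a) |f|^2, and
    polarization once more identifies T there.  For E(Spec L) to make sense
    Spec L must be Borel: it is closed, by a Neumann series. *)

Set Implicit Arguments.
Unset Strict Implicit.
Unset Printing Implicit Defensive.

Import Order.TTheory GRing.Theory Num.Theory.
Import numFieldNormedType.Exports.

Local Open Scope classical_set_scope.
Local Open Scope ring_scope.
Local Open Scope complex_scope.

(** * Operator norms and Fourier sums *)

Section RealNorm.
Context (R : realType) (V : normedZmodType R[i]).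

Lemma rnormE (x : V) : `|x| = (rnorm x)%:C.
Proof. by rewrite /rnorm RRe_real// normr_real. Qed.

Lemma rnorm_ge0 (x : V) : 0 <= rnorm x.
Proof. by rewrite -ler0c -rnormE. Qed.

Lemma rnorm_eq0 (x : V) : rnorm x = 0 -> x = 0.
Proof. by move=> x0; apply/normr0_eq0; rewrite rnormE x0. Qed.

Lemma ler_rnormD (x y : V) : rnorm (x + y) <= rnorm x + rnorm y.
Proof. by rewrite -lecR rmorphD/= -!rnormE ler_normD. Qed.

Lemma rnorm0 : rnorm (0 : V) = 0.
Proof. by rewrite /rnorm normr0. Qed.

End RealNorm.

Lemma rnormZ (R : realType) (V : normedModType R[i]) (a : R[i]) (x : V) :
  rnorm (a *: x) = rnorm a * rnorm x.
Proof. by rewrite {1}/rnorm normrZ !rnormE -rmorphM. Qed.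

Section OperatorNorm.
Context (R : realType) (U V : normedModType R[i]).

Lemma continuous_rnorm_le (T : {linear U -> V}) : continuous T ->
  exists2 M : R, 0 < M & forall x, rnorm (T x) <= M * rnorm x.
Proof.
move=> /linear_bounded_continuous/linear_boundedP/pinfty_ex_gt0[M M0 TM].
have ME : M = (complex.Re M)%:C by rewrite RRe_real// gtr0_real.
exists (complex.Re M); first by rewrite -ltcR -ME.
by move=> x; rewrite -lecR rmorphM/= -ME -!rnormE.
Qed.

(** [sup] is informative only on a set bounded above, so every estimate through [opnorm] rests on
    this bound. The sign of [M] is not known, hence [|M|] in the proof. *)
Lemma has_ubound_opnorm (T : {linear U -> V}) (M : R) :
  (forall x, rnorm (T x) <= M * rnorm x) ->
  has_ubound [set rnorm (T x) | x in [set x | rnorm x <= 1]].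
Proof.
move=> TM; exists `|M| => _ [y /= y1 <-]; rewrite (le_trans (TM y))//.
rewrite (le_trans (ler_norm _))// normrM ler_piMr// ger0_norm//.
exact: rnorm_ge0.
Qed.

Lemma opnorm_ge0 (T : {linear U -> V}) (M : R) :
  (forall x, rnorm (T x) <= M * rnorm x) -> 0 <= opnorm T.
Proof.
move=> TM; apply: (ub_le_sup (has_ubound_opnorm TM)); exists 0 => /=.
  by rewrite rnorm0 ler01.
by rewrite linear0 rnorm0.
Qed.

(** A nonzero [x] is rescaled to norm one, where the supremum applies directly. *)
Lemma le_opnorm (T : {linear U -> V}) (M : R) x :
  (forall x, rnorm (T x) <= M * rnorm x) ->
  rnorm (T x) <= opnorm T * rnorm x.
Proof.
move=> TM; have [->|x0] := eqVneq x 0.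
  by rewrite linear0 !rnorm0 mulr0.
have nx0 : 0 < rnorm x.
  by rewrite lt_neqAle rnorm_ge0 andbT eq_sym; apply/contra_neq: x0 => /rnorm_eq0.
rewrite -ler_pdivrMr// mulrC.
have -> : (rnorm x)^-1 * rnorm (T x) = rnorm (T ((rnorm x)^-1%:C *: x)).
  rewrite linearZ rnormZ; congr (_ * _).
  by rewrite /rnorm ger0_norm// ler0c invr_ge0 ltW.
apply: (ub_le_sup (has_ubound_opnorm TM)); exists ((rnorm x)^-1%:C *: x) => //=.
rewrite rnormZ {1}/rnorm ger0_norm ?ler0c ?invr_ge0 ?(ltW nx0)//=.
by rewrite mulVf// lt0r_neq0.
Qed.

End OperatorNorm.

Section LinSpan.
Context (R : realType) (H : completeNormedModType R[i]).
Variable e : nat -> H.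

Lemma lin_spanP k a v w : lin_span e k v -> lin_span e k w ->
  lin_span e k (a *: v + w).
Proof.
move=> [c ->] [d ->]; exists (fun j => a * c j + d j).
rewrite scaler_sumr -big_split; apply: eq_bigr => i _.
by rewrite scalerA scalerDl.
Qed.

Lemma lin_spanB k v w : lin_span e k v -> lin_span e k w ->
  lin_span e k (v - w).
Proof. by move=> kv kw; rewrite addrC -scaleN1r; exact: lin_spanP. Qed.

Lemma lin_span_gen k j : (j < k)%N -> lin_span e k (e j).
Proof.
move=> jk; exists (fun i => (i == Ordinal jk)%:R).
by rewrite (bigD1 (Ordinal jk))//= big1 ?addr0 ?eqxx ?scale1r// => i /negPf ->;
  rewrite scale0r.
Qed.

Lemma lin_span_sum k I (s : seq I) (c : I -> R[i]) (u : I -> H) :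
  (forall i, lin_span e k (u i)) -> lin_span e k (\sum_(i <- s) c i *: u i).
Proof.
move=> ku; elim/big_rec: _ => [|i v _ kv]; last exact: lin_spanP.
by exists (fun=> 0); rewrite big1// => i _; rewrite scale0r.
Qed.

End LinSpan.

Section Fourier.
Context (R : realType) (H : completeNormedModType R[i]).
Variables (ip : {dot H for Num.conj}) (hip : norm_of_dot ip).

Lemma ipC x y : ip x y = (ip y x)^*%R.
Proof. by rewrite (@hermitian_subproof _ _ _ _ ip) expr0 mul1r. Qed.

Lemma ip_eq0C x y : ip x y = 0 -> ip y x = 0.
Proof. by move=> xy; rewrite ipC xy conjC0. Qed.

Lemma ip0 x : ip x x = 0 -> x = 0.
Proof. by move=> /eqP; rewrite dnorm_eq0 => /eqP. Qed.

Lemma ip_inj x y : (forall z, ip x z = ip y z) -> x = y.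
Proof. by move=> xy; apply/subr0_eq/ip0; rewrite linearBl/= xy subrr. Qed.

Section Orthonormal.
Variable e : nat -> H.
Hypothesis one : forall i j, ip (e i) (e j) = (i == j)%:R.

Lemma ip_fourier_sum x k j : (j < k)%N ->
  ip (fourier_sum ip e x k) (e j) = ip x (e j).
Proof.
move=> jk; rewrite /fourier_sum linear_sumlz (bigD1 (Ordinal jk))//= big1.
  by rewrite addr0 linearZl_LR/= one eqxx mulr1.
move=> i ij; rewrite linearZl_LR/= one (_ : (_ == _) = false) ?mulr0//.
by apply: contra_neqF ij => /eqP ij; apply/val_inj.
Qed.

Lemma orth_fourier_sum x k v : lin_span e k v ->
  ip (x - fourier_sum ip e x k) v = 0.
Proof.
move=> [c ->]; rewrite linear_sumr big1// => i _.
by rewrite linearZr_LR/= linearBl/= ip_fourier_sum// subrr mulr0.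
Qed.

Lemma lin_span_fourier_sum x k : lin_span e k (fourier_sum ip e x k).
Proof. by exists (fun j => ip x (e j)). Qed.

(** Pythagoras: [x - v] splits into the residual of the Fourier sum and a vector of the span, to
    which the residual is orthogonal. *)
Lemma fourier_sum_best x k v : lin_span e k v ->
  `|x - fourier_sum ip e x k| <= `|x - v|.
Proof.
move=> kv; rewrite -ler_sqr ?nnegrE// !hip.
have <- : x - fourier_sum ip e x k + (fourier_sum ip e x k - v) = x - v.
  by rewrite addrA subrK.
set w := fourier_sum _ _ _ _ - v; have ow : ip (x - fourier_sum ip e x k) w = 0.
  by apply/orth_fourier_sum/lin_spanB => //; exact: lin_span_fourier_sum.
by rewrite [leRHS]dnormD ow conjC0 !addr0 lerDl dnorm_ge0.
Qed.

Lemma fourier_sum_dist_nonincr x k l : (k <= l)%N ->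
  `|x - fourier_sum ip e x l| <= `|x - fourier_sum ip e x k|.
Proof.
move=> kl; apply: fourier_sum_best.
(* The shorter Fourier sum, padded with zeros, competes in the larger span. *)
exists (fun j => if (j < k)%N then ip x (e j) else 0).
rewrite /fourier_sum (big_ord_widen l (fun j => ip x (e j) *: e j))// big_mkcond.
by apply: eq_bigr => i _; case: ifP => //; rewrite scale0r.
Qed.

(** The difference of the two candidates lies in the span and is also orthogonal to it, hence to
    itself. *)
Lemma orth_projectorE k P x : orth_projector ip (lin_span e k) P ->
  P x = fourier_sum ip e x k.
Proof.
move=> /(_ x)[kP oP]; apply/subr0_eq/ip0.
set w := P x - _; have kw : lin_span e k w.
  by apply: lin_spanB => //; exact: lin_span_fourier_sum.
have -> : ip w w = ip (x - fourier_sum ip e x k) w - ip (x - P x) w.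
  by rewrite -linearBl/= opprB [X in _ = ip X _]addrC addrA subrK.
by rewrite oP// orth_fourier_sum// subr0.
Qed.

End Orthonormal.

(** Density gives one finite combination close to [x]; best approximation and monotonicity of the
    residuals carry the bound to all later sums. *)
Lemma fourier_cvg e x : orthonormal_basis ip e ->
  fourier_sum ip e x @ \oo --> x.
Proof.
move=> [one de]; apply/cvgrPdist_lt => eps eps0.
have xx : ball x eps !=set0 by exists x; exact: ballxx.
have [v [/= xv [k _ kv]]] := de _ xx (ball_open x eps).
rewrite -ball_normE in xv.
exists k => //= n /= kn; rewrite (le_lt_trans _ xv)//.
rewrite (le_trans (fourier_sum_dist_nonincr one x kn))//.
exact: fourier_sum_best.
Qed.

Lemma orthonormal_basis_reindex e s : bijective s ->
  orthonormal_basis ip e -> orthonormal_basis ip (e \o s).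
Proof.
move=> bs [one de]; split=> [i j|].
  by rewrite /= one (inj_eq (bij_inj bs)).
move: bs => [t st ts] U U0 oU; have [v [Uv [k _ [c vE]]]] := de U U0 oU.
(* With [t] the inverse of [s], this length is large enough for the permuted family to contain each
   [e j] with [j < k]. *)
exists v; split=> //; exists (\max_(j < k) (t j).+1)%N => //.
rewrite vE; apply: lin_span_sum => j; rewrite -[e j]/(e (nat_of_ord j)).
rewrite -[nat_of_ord j]ts -[e _]/((e \o s) (t j)); apply: lin_span_gen.
by rewrite (bigD1 j)//= leq_max leqnn.
Qed.

End Fourier.

(** * Openness of the resolvent set *)

Lemma rnorm_le_continuous (R : realType) (U V : normedModType R[i])
    (T : {linear U -> V}) (M : R) :
  (forall x, rnorm (T x) <= M * rnorm x) -> continuous T.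
Proof.
move=> TM; apply/linear_bounded_continuous/bounded_funP => r.
exists (`|M|%:C * r) => x xr; rewrite rnormE (@le_trans _ _ (`|M| * rnorm x)%:C)//.
  rewrite lecR (le_trans (TM x))// ler_wpM2r ?rnorm_ge0//; exact: ler_norm.
by rewrite rmorphM/= -rnormE ler_wpM2l// ler0c.
Qed.

Section Resolvent.
Context (R : realType) (H : completeNormedModType R[i]).

(** The iterates of [x => y + T x] from 0 stay bounded by [2 * rnorm y], and each step halves their
    differences, so they form a Cauchy sequence whose limit is a fixed point. *)
Lemma neumann (T : {linear H -> H}) :
  (forall x, rnorm (T x) <= 2^-1 * rnorm x) ->
  forall y, exists x, x = y + T x.
Proof.
move=> T2 y; pose s n := iter n (fun x => y + T x) 0.
have s2 m : rnorm (s m) <= 2 * rnorm y.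
  elim: m => [|m ih]; first by rewrite rnorm0 mulr_ge0 ?rnorm_ge0.
  rewrite (le_trans (ler_rnormD _ _))//.
  by have := T2 (s m); lra.
have sC n m : rnorm (s n - s (n + m)%N) <= 2^-1 ^+ n * (2 * rnorm y).
  elim: n => [|n ih].
    by rewrite expr0 mul1r sub0r add0n /rnorm normrN; exact: s2.
  rewrite addSn [s n.+1]/= [s (n + m).+1]/= opprD addrACA subrr add0r -linearB.
  rewrite (le_trans (T2 _))// exprS -mulrA ler_wpM2l//.
have : cvg (s @ \oo).
  apply/cauchy_cvgP/cauchy_exP => eps eps0.
  have epsE : eps = (complex.Re eps)%:C by rewrite RRe_real// gtr0_real.
  set d := complex.Re eps in epsE; have d0 : 0 < d by rewrite -ltcR -epsE.
  (* Since [n < 2 ^ n], this [n] makes the bound of [sC] smaller than [d]. *)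
  have [n nB] : exists n : nat, 2 * rnorm y / d < n%:R.
    exists (Num.bound (2 * rnorm y / d)); apply: archi_boundP.
    by rewrite divr_ge0 ?mulr_ge0 ?rnorm_ge0 ?ltW.
  exists (s n); exists n => // k /= nk.
  rewrite -ball_normE/= rnormE epsE ltcR -(subnKC nk) (le_lt_trans (sC _ _))//.
  rewrite exprVn ltr_pdivrMl ?exprn_gt0// -ltr_pdivrMr// (lt_trans nB)//.
  by rewrite -natrX ltr_nat ltn_expl.
move=> /cvg_ex[x sx]; exists x.
have Tc : continuous T by exact: rnorm_le_continuous T2.
have : s n.+1 @[n --> \oo] --> y + T x.
  by apply: cvgD; [exact: cvg_cst|apply: continuous_cvg => //; exact: Tc].
rewrite (cvg_shiftS s) => sy.
exact: (cvg_unique _ sx sy).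
Qed.

(** If [B] inverts L - z and c = w - z, then L - w = (L - z) - c is inverted by B (I - cB)^-1. The
    radius 1/(2M) makes the norm of cB at most 1/2, so that the Neumann series applies. *)
Lemma open_resolvent_set (L : operator H) :
  open (resolvent_set L : set R[i]^o).
Proof.
rewrite openE => z [B [Bc LB BL]].
have [M M0 BM] := continuous_rnorm_le Bc.
apply/nbhs_ballP; exists ((2 * M)^-1)%:C => /=.
  by rewrite ltcR invr_gt0 mulr_gt0.
move=> w /=; rewrite -ball_normE/= distrC => wz.
pose c := w - z.
have {}wz : rnorm c < (2 * M)^-1 by rewrite -ltcR -rnormE.
have cM x : rnorm (c *: B x) <= 2^-1 * rnorm x.
  rewrite rnormZ (le_trans (ler_wpM2l (rnorm_ge0 _) (BM x)))//.
  rewrite mulrA ler_wpM2r ?rnorm_ge0// -ler_pdivlMr// -invfM ltW//.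
have cB_lin : linear (fun x => c *: B x).
  by move=> a x y; rewrite linearP scalerDr !scalerA mulrC.
pose T : {linear H -> H} := HB.pack (fun x => c *: B x)
  (GRing.isLinear.Build _ _ _ _ (fun x => c *: B x) cB_lin).
have /choice[G GE] : forall y, exists x, x = y + T x by exact: neumann.
(* Solutions are unique because [T] is a contraction; the linearity of [G], which was obtained by
   choice, and the left inverse property follow from this. *)
have Gu x y : x = y + T x -> G y = x.
  move=> xE; have dE : G y - x = T (G y - x).
    by rewrite linearB {1}GE {1}xE opprD addrACA subrr add0r.
  apply/subr0_eq/rnorm_eq0/eqP; rewrite eq_le rnorm_ge0 andbT.
  by have := cM (G y - x); rewrite -[c *: _]/(T _) -dE; lra.
have F_lin : linear (B \o G).
  move=> a x y /=; rewrite -linearP; congr (B _); apply: Gu.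
  by rewrite linearP {1}(GE x) {1}(GE y) scalerDr addrACA.
pose F : {linear H -> H} := HB.pack (B \o G)
  (GRing.isLinear.Build _ _ _ _ (B \o G) F_lin).
exists F; split.
(* The factor 2 bounds [G]: the norm of [G y] is at most that of [y] plus half of itself. *)
- apply: (@rnorm_le_continuous _ _ _ _ (M * 2)) => y.
  rewrite (le_trans (BM _))// -mulrA ler_wpM2l ?(ltW M0)//.
  have : rnorm (G y) <= rnorm y + 2^-1 * rnorm (G y).
    by rewrite {1}GE (le_trans (ler_rnormD _ _))// lerD2l; exact: cM.
  lra.
- move=> y; have [dG LG] := LB (G y); split=> //.
  rewrite /F/= -{1}[w](subrK z) -/c scalerDl opprD.
  by rewrite addrCA LG addrC {1}GE addrK.
- move=> x dx; rewrite /F/=.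
  have Bx : B (L x - z *: x) = x by exact: BL.
  rewrite (@Gu (L x - z *: x))// /T/= Bx /c scalerBl.
  by rewrite addrA subrK.
Qed.

End Resolvent.

(** * Measures on the Borel sets of the complex plane *)

Section Measurability.
Context (R : realType).

Lemma open_measurableC (U : set R[i]^o) : open U -> measurable (U : set (borelC R)).
Proof. by move=> oU; exact: sub_sigma_algebra. Qed.

(** Preimages of the open rays that generate the Borel sets of the line are open, by the Lipschitz
    bound. *)
Lemma lipschitz_measurableC (h : borelC R -> R) :
  (forall z w : R[i], `|h z - h w| <= rnorm (z - w)) ->
  measurable_fun setT h.
Proof.
move=> h1 mT; apply: (measurability _ (RGenOInfty.measurableE R)) => //.
move=> /= _ [_ [x ->] <-]; rewrite setTI.
apply: open_measurableC; rewrite openE => z /=; rewrite in_itv/= andbT => xz.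
apply/nbhs_ballP; exists (h z - x)%:C => /=.
  by rewrite ltcR subr_gt0.
move=> w; rewrite -ball_normE/= rnormE ltcR in_itv/= andbT => zw.
have := le_lt_trans (h1 z w) zw.
by move=> /(le_lt_trans (ler_norm _)); lra.
Qed.

Lemma ler_rnorm_Re (z : R[i]) : `|complex.Re z| <= rnorm z.
Proof. by rewrite -lecR -rnormE normc_ge_Re. Qed.

Lemma ler_rnorm_Im (z : R[i]) : `|complex.Im z| <= rnorm z.
Proof.
have := normc_ge_Re (z * 'i%C); rewrite ReiNIm normrN normrM.
suff -> : `|'i%C : R[i]| = 1 by rewrite mulr1 rnormE lecR.
by rewrite normc_def/= expr0n/= add0r expr1n sqrtr1.
Qed.

Lemma measurable_Re : measurable_fun setT (@complex.Re R : borelC R -> R).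
Proof.
by apply: lipschitz_measurableC => z w; rewrite -raddfB/= ler_rnorm_Re.
Qed.

Lemma measurable_Im : measurable_fun setT (@complex.Im R : borelC R -> R).
Proof.
by apply: lipschitz_measurableC => z w; rewrite -raddfB/= ler_rnorm_Im.
Qed.

Lemma measurableC1 (a : borelC R) : measurable [set a].
Proof.
rewrite (_ : [set a] = (@complex.Re R : borelC R -> R) @^-1` [set complex.Re a]
    `&` (@complex.Im R : borelC R -> R) @^-1` [set complex.Im a]); last first.
  apply/seteqP; split=> [z ->//|z [/= az bz]].
  by apply/eqP; rewrite eq_complex az bz !eqxx.
apply: measurableI.
- by rewrite -[X in measurable X]setTI; apply: measurable_Re.
- by rewrite -[X in measurable X]setTI; apply: measurable_Im.
Qed.

End Measurability.

(** * Mean values and atoms for a finite measure *)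

Section NullMean.
Context d (T : measurableType d) (R : realType) (mu : {measure set T -> \bar R}).
Hypothesis mufin : (mu setT < +oo)%E.
Variable D : set T.
Hypothesis mD : measurable D.

Let muD : (mu D < +oo)%E.
Proof. by apply: le_lt_trans mufin; rewrite le_measure ?inE. Qed.

(** The function [h - c] is positive almost everywhere but has integral zero over [D]; it therefore
    vanishes almost everywhere on [D], which is possible only if [D] is null. *)
Lemma null_of_mean (A : set T) (h : T -> R) (c : R) :
  measurable A -> mu (~` A) = 0 -> mu.-integrable D (EFin \o h) ->
  (forall z, A z -> c < h z) ->
  \int[mu]_(z in D) h z = c * fine (mu D) -> mu D = 0.
Proof.
move=> mA A0 ih ch hc.
have ic : mu.-integrable D (EFin \o cst c).
  apply/integrableP; split; first by apply/measurable_EFinP; exact: measurable_cst.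
  rewrite (_ : (fun _ => _) = cst (`|c|)%:E)// integral_cst//.
  by rewrite lte_mul_pinfty// lee_fin.
pose f := ((EFin \o h) \- (EFin \o cst c))%E.
have if_ : mu.-integrable D f by exact: integrableB.
have mf : measurable_fun D f by exact: measurable_int if_.
have f0 : (\int[mu]_(z in D) f z = 0)%E.
  rewrite -[LHS]fineK; last exact: integrable_fin_num.
  by rewrite [fine _](RintegralB mD ih ic) hc Rintegral_cst// subrr.
have fA : ae_eq mu D f (abse \o f).
  exists (~` A); split=> //; first exact: measurableC.
  move=> z /= /not_implyP[Dz]; apply: contra_not => Az.
  by rewrite /f/= ger0_norm// subr_ge0 ltW// ch.
have : (\int[mu]_(z in D) `|f z| = 0)%E.
  by rewrite -f0; apply: ae_eq_integral => //;
    [exact: measurableT_comp|exact: ae_eq_sym].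
move=> /(ae_eq_integral_abs mu mD mf) [N [mN N0 DN]].
apply: measure_negligible => //.
(* [f] vanishes on [D] outside [N] and is positive on [A], so [D] is covered by these two null
   sets. *)
have : mu.-negligible (N `|` ~` A).
  by apply: negligibleU; apply/negligibleP => //; exact: measurableC.
apply: negligibleS => z Dz; have [Az|nAz] := pselect (A z); last by right.
left; apply: DN => /= /(_ Dz) [] /eqP.
by rewrite subr_eq0 gt_eqF// ch.
Qed.

Lemma Rintegral_atom (a : T) (f : T -> R) :
  measurable [set a] -> mu (~` [set a]) = 0 -> measurable_fun D f ->
  \int[mu]_(z in D) f z = f a * fine (mu D).
Proof.
move=> ma a0 mf; rewrite -Rintegral_cst//; congr fine.
apply: ae_eq_integral => //; first exact/measurable_EFinP.
exists (~` [set a]); split=> //; first exact: measurableC.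
by move=> z /= /not_implyP[Dz]; apply: contra_not => ->.
Qed.

End NullMean.

(** * Spectral measures *)

Lemma ip_norm (R : realType) (H : completeNormedModType R[i])
    (ip : {dot H for Num.conj}) (hip : norm_of_dot ip) x :
  ip x x = (rnorm x ^+ 2)%:C.
Proof. by rewrite -hip rnormE rmorphXn. Qed.

(** The values c = 1 and c = -1 give K = 0, hence p + q = 0; then c = i gives p = q. *)
Lemma polarization0 (C : numClosedFieldType) (K p q : C) :
  (forall c : C, `|c| = 1 -> c^* * p + c * q = K) -> p = 0 /\ q = 0.
Proof.
move=> pq; have c1 := pq 1 (normr1 _); have cN := pq (-1) (normrN1 _).
have ci := pq 'i%R (normCi _).
have x2 (x : C) : x + x = 0 -> x = 0.
  by move/eqP; rewrite -mulr2n mulrn_eq0 => /eqP.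
rewrite conjC1 !mul1r in c1; rewrite rmorphN rmorph1 !mulN1r in cN.
have K0 : K = 0 by apply: x2; rewrite -{1}c1 -cN addrACA !subrr addr0.
rewrite conjCi mulNr addrC -mulrBr K0 in ci.
move/eqP: ci; rewrite mulf_eq0 (negPf (neq0Ci _)) subr_eq0 => /eqP qp.
by rewrite qp K0 in c1 *; have := x2 _ c1.
Qed.

(** Four independent vectors are allowed so that the quadratic form of an operator at a sum
    [u + c *: v] can be expanded as well. *)
Lemma dot_addZ (R : realType) (H : lmodType R[i]) (ip : {dot H for Num.conj})
    (c : R[i]) u u' v v' :
  ip (u + c *: u') (v + c *: v') =
  ip u v + (c^*)%R * ip u v' + (c * ip u' v + c * (c^*)%R * ip u' v').
Proof.
have ipZ w w' : ip w (c *: w') = (c^*)%R * ip w w' by rewrite linearZr_LR.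
by rewrite linearDl/= linearZl_LR/= !linearDr/= !ipZ; ring.
Qed.

Section Projections.
Context (R : realType) (H : completeNormedModType R[i]).
Variables (ip : {dot H for Num.conj}) (hip : norm_of_dot ip).
Variable E : spectral_measure ip.

Lemma proj_idem A x : measurable A -> E A (E A x) = E A x.
Proof. by move=> mA; rewrite -projI// setIid. Qed.

Lemma projC A B x : measurable A -> measurable B -> E A (E B x) = E B (E A x).
Proof. by move=> mA mB; rewrite -!projI// setIC. Qed.

Lemma proj_orth A x y : measurable A -> ip (E A x) (y - E A y) = 0.
Proof.
move=> mA; rewrite linearBr/= -(proj_selfadjoint E mA (E A x) y).
by rewrite proj_idem// subrr.
Qed.

Lemma diag_rnorm A x : measurable A -> diag E x A = (rnorm (E A x) ^+ 2)%:E.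
Proof.
move=> mA; rewrite diagE//; congr (_%:E).
have -> : ip (E A x) x = ip (E A x) (E A x).
  by rewrite -proj_selfadjoint// proj_idem.
by rewrite ip_norm.
Qed.

Lemma proj_set0 x : E set0 x = 0.
Proof.
apply/rnorm_eq0/eqP; rewrite -sqrf_eq0 -eqe -diag_rnorm//.
by rewrite measure0.
Qed.

Lemma diag_eq0 A x : measurable A -> diag E x A = 0 -> E A x = 0.
Proof.
move=> mA; rewrite diag_rnorm// => /eqP.
by rewrite eqe sqrf_eq0 => /eqP/rnorm_eq0.
Qed.

Lemma diagT x : diag E x setT = (rnorm x ^+ 2)%:E.
Proof. by rewrite diag_rnorm// projT. Qed.

(* Multiplication by [c] on the range of [E (~` A)] is a unitary operator when
   [`|c| = 1] and commutes with [E], so it leaves the scalar measures, and with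
   them the quadratic form of a spectral integral, unchanged. *)
Lemma diag_phase A (c : R[i]) x B : measurable A -> measurable B -> `|c| = 1 ->
  diag E (E A x + c *: (x - E A x)) B = diag E x B.
Proof.
move=> mA mB c1; rewrite !diag_rnorm// -[E B x](subrK (E A (E B x))).
rewrite [_ - _ + _]addrC linearD linearZ linearB /= (projC x mB mA).
(* Both sides are now computed by Pythagoras from the orthogonal components [E A y] and [y - E A y];
   the factor [c] does not change the norm of the second. *)
set y := E B x; congr (_%:E); apply: complexI; rewrite -!(ip_norm hip).
have o := proj_orth y y mA.
move: (y - E A y) o => v o.
have oc : ip (E A y) (c *: v) = 0 by rewrite linearZr_LR/= o mulr0.
rewrite !dnormD oc o conjC0 !addr0; congr (_ + _).
by rewrite dnormZ c1 expr1n mul1r.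
Qed.

Section SpectralIntegral.
Variables (D : set (borelC R)) (g : borelC R -> R[i]) (T : operator H).
Hypothesis ET : spectral_integral E D g T.

Lemma domZ a x : dom T x -> dom T (a *: x).
Proof.
by move=> dx; rewrite -[_ *: x]addr0; apply: dom_linear => //; exact: dom0.
Qed.

Lemma domD x y : dom T x -> dom T y -> dom T (x + y).
Proof. by move=> dx dy; rewrite -[x]scale1r; exact: dom_linear. Qed.

Lemma appD x y : dom T x -> dom T y -> T (x + y) = T x + T y.
Proof. by move=> dx dy; rewrite -[x in LHS]scale1r app_linear// scale1r. Qed.

Lemma appZ a x : dom T x -> T (a *: x) = a *: T x.
Proof.
move=> dx; have T0 : T 0 = 0.
  have := appD (dom0 T) (dom0 T); rewrite addr0 => T0.
  by apply: (@addrI _ (T 0)); rewrite addr0 -T0.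
by rewrite -[a *: x]addr0 app_linear ?T0 ?addr0//; exact: dom0.
Qed.

Lemma dom_phase A (c : R[i]) x : measurable A -> `|c| = 1 -> dom T x ->
  dom T (E A x + c *: (x - E A x)).
Proof.
move=> mA c1; case: ET => -> _ /=; set y := _ + _.
rewrite [X in _ -> (X < _)%E](eq_measure_integral (diag E x))//.
by move=> B mB _; exact: diag_phase.
Qed.

Lemma quadratic_phase A (c : R[i]) x (y := E A x + c *: (x - E A x)) :
  measurable A -> `|c| = 1 -> dom T x -> ip (T y) y = ip (T x) x.
Proof.
move=> mA c1 dx; case: (ET) => _ Tip.
rewrite !Tip//; last exact: dom_phase.
rewrite /cintegral /Rintegral; congr Complex; congr fine;
  by apply: eq_measure_integral => B mB _; exact: diag_phase.
Qed.

(** [E A x] is half the sum of [x] and its image under the phase change with c = -1. *)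
Lemma dom_proj A x : measurable A -> dom T x -> dom T (E A x).
Proof.
move=> mA dx; have := dom_phase mA (normrN1 _) dx.
rewrite scaleN1r opprB addrA => /(domD dx).
rewrite addrCA subrr addr0 -mulr2n -scaler_nat => /(domZ 2^-1).
by rewrite scalerA mulVf ?scale1r// pnatr_eq0.
Qed.

Lemma dom_projC A x : measurable A -> dom T x -> dom T (x - E A x).
Proof.
move=> mA dx; rewrite -scaleN1r addrC; apply: domD => //.
by apply: domZ; exact: dom_proj.
Qed.

(** The form at [u + c *: v] is the same for all unimodular [c], so its cross terms,
    conjugate-linear and linear in [c], have a constant sum and vanish by [polarization0]. *)
Lemma proj_reduces A x : measurable A -> dom T x ->
  ip (T (E A x)) (x - E A x) = 0 /\ ip (T (x - E A x)) (E A x) = 0.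
Proof.
move=> mA dx; have du := dom_proj mA dx; have dv := dom_projC mA dx.
have := fun c (c1 : `|c| = 1) => quadratic_phase mA c1 dx.
move: du dv; move: (x - E A x) => v; move: (E A x) => u du dv key.
apply: (@polarization0 _ (ip (T x) x - ip (T u) u - ip (T v) v)) => c c1.
rewrite -(key c c1) appD//; last exact: domZ.
rewrite appZ// dot_addZ -normCK c1 expr1n mul1r.
by ring.
Qed.

End SpectralIntegral.

End Projections.

(** * Eigenvectors of L and atoms of its spectral measure *)

Lemma measurable_rnorm (R : realType) :
  measurable_fun setT (@rnorm R R[i] : borelC R -> R).
Proof.
apply: lipschitz_measurableC => z w; rewrite ler_norml.
have zw : rnorm z <= rnorm (z - w) + rnorm w.
  by rewrite -[z in leLHS](subrK w) ler_rnormD.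
have wz : rnorm w <= rnorm (z - w) + rnorm z.
  rewrite -[w in leLHS](subrK z) (le_trans (ler_rnormD _ _))//.
  by rewrite /rnorm distrC.
by lra.
Qed.

Section EigenProjection.
Context (R : realType) (H : completeNormedModType R[i]).
Variables (ip : {dot H for Num.conj}) (hip : norm_of_dot ip).
Variables (E : spectral_measure ip) (D : set (borelC R)).
Hypotheses (mD : measurable D) (ED : forall x, E D x = x).

Lemma diag_fin x : (diag E x setT < +oo)%E.
Proof. by rewrite diagT// ltry. Qed.

Lemma diag_support x : diag E x D = (rnorm x ^+ 2)%:E.
Proof. by rewrite diag_rnorm// ED. Qed.

Section EigenOperator.
Variable L : operator H.
Hypothesis EL : spectral_integral E D (fun z => z) L.

(** The domain condition makes |z|^2 integrable, and |z| <= 1 + |z|^2 with a finite measure. *)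
Lemma integrable_coordinate (k : borelC R -> R) x :
  measurable_fun setT k -> (forall z, `|k z| <= rnorm (z : R[i])) -> dom L x ->
  (diag E x).-integrable D (EFin \o k).
Proof.
move=> mk k1; case: EL => -> _ /= Dx.
pose g (z : borelC R) := (1%:E + (rnorm (z : R[i]) ^+ 2)%:E)%E.
have msq : measurable_fun D (fun z : borelC R => (rnorm (z : R[i]) ^+ 2)%:E).
  apply/measurable_EFinP; apply: measurable_funX.
  exact: measurable_funS (@measurable_rnorm R).
apply: (@le_integrable _ _ _ _ _ mD _ g).
- by apply/measurable_EFinP; exact: measurable_funS mk.
- move=> z _; rewrite /g /= lee_fin [leRHS]ger0_norm; last first.
    by rewrite addr_ge0// sqr_ge0.
  apply: (le_trans (k1 z)).
  have := sqr_ge0 (rnorm (z : R[i]) - 2^-1); nra.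
- apply: integrableD => //; apply/integrableP; split.
  + exact/measurable_EFinP.
  + rewrite (_ : (fun _ => _) = cst 1%:E); last first.
      by apply/funext => z; rewrite /= normr1.
    by rewrite integral_cst// mul1e diag_support ltry.
  + exact: msq.
  + rewrite (eq_integral (fun z : borelC R => (rnorm (z : R[i]) ^+ 2)%:E))//.
    by move=> z _; rewrite /= ger0_norm// sqr_ge0.
Qed.

(** Here [k] stands for the real or the imaginary part and [s] for a sign, so that four open
    half-planes with [a] on the boundary are treated at once. The hypotheses on [k] let it commute
    with the integral and with real factors. *)
Lemma eigen_halfplane (k : R[i] -> R) (s : R) (a : R[i]) x :
  measurable_fun setT (k : borelC R -> R) ->
  (forall z, `|k z| <= rnorm z) ->
  (forall z r, k (z * r%:C) = k z * r) ->
  (forall y, dom L y -> \int[diag E y]_(z in D) k z = k (ip (L y) y)) ->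
  dom L x -> L x = a *: x ->
  (diag E x).-negligible [set z : borelC R | s * k a < s * k z].
Proof.
move=> mk k1 kM kint dx Lx; set A := [set z | _].
have msk : measurable_fun setT (fun z : borelC R => s * k z).
  by apply: measurable_funM => //; exact: measurable_cst.
have mA : measurable (A : set (borelC R)).
  rewrite (_ : A = (fun z : borelC R => s * k z) @^-1` `]s * k a, +oo[); last first.
    by apply/seteqP; split=> z /=; rewrite in_itv/= andbT.
  by rewrite -[X in measurable X]setTI; exact: msk.
set u := E A x; have du : dom L u by exact: dom_proj EL _ _ mA dx.
have [_ o] := proj_reduces hip EL mA dx.
(* The component of [x] off the range of [E A] contributes to neither side, so the eigenvalue
   equation passes to [u]. *)
have Lu : ip (L u) u = a * ip u u.
  have -> : ip (L u) u = ip (L x) u.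
    rewrite -[x in RHS](subrK u) appD//; last exact: dom_projC EL _ _ mA dx.
    by rewrite linearDl/= o add0r.
  rewrite Lx linearZl_LR/=; congr (_ * _).
  by rewrite -[x in LHS](subrK u) linearDl/= (ip_eq0C (proj_orth _ x x mA)) add0r.
have ik : (diag E u).-integrable D (EFin \o (k : borelC R -> R)).
  exact: integrable_coordinate.
apply/negligibleP => //; suff : diag E u D = 0.
  move/(diag_eq0 hip mD); rewrite ED => u0.
  by rewrite [LHS](diag_rnorm hip E x mA) -/u u0 rnorm0 expr0n.
apply: (@null_of_mean _ _ _ _ (diag_fin u) _ mD A (fun z => s * k z)
  (s * k a)) => //.
- rewrite diag_rnorm//; last exact: measurableC.
  rewrite /u -projI//; last exact: measurableC.
  by rewrite setICl proj_set0// rnorm0 expr0n.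
- by rewrite (_ : _ \o _ = (fun z => s%:E * (EFin \o k) z)%E)//; exact: integrableZl.
- by rewrite RintegralZl// kint// Lu ip_norm// kM diag_support mulrA.
Qed.

Lemma eigen_proj (a : R[i]) x : dom L x -> L x = a *: x -> E [set a] x = x.
Proof.
move=> dx Lx.
have cint y : dom L y -> cintegral (diag E y) D (fun z => z) = ip (L y) y.
  by move=> dy; case: EL => _ ->.
have re s : (diag E x).-negligible
    [set z : borelC R | s * complex.Re a < s * complex.Re z].
  apply: eigen_halfplane => //; first exact: measurable_Re.
  - exact: ler_rnorm_Re.
  - by case=> b c r /=; rewrite mulr0 subr0.
  - by move=> y dy; rewrite -(cint y dy).
have im s : (diag E x).-negligible
    [set z : borelC R | s * complex.Im a < s * complex.Im z].
  apply: eigen_halfplane => //; first exact: measurable_Im.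
  - exact: ler_rnorm_Im.
  - by case=> b c r /=; rewrite mulr0 add0r.
  - by move=> y dy; rewrite -(cint y dy).
have ma := measurableC1 a; have mna := measurableC ma.
(* The complement of the point is the union of the four half-planes. *)
have : (diag E x).-negligible (~` [set a]).
  apply: negligibleS (negligibleU (negligibleU (re 1) (re (-1)))
                                  (negligibleU (im 1) (im (-1)))).
  move=> z /= /eqP; rewrite eq_complex negb_and !neq_lt !mulN1r !mul1r !ltrN2.
  by move=> /orP[] /orP[] ->; [left; right|left; left|right; right|right; left].
move=> /(negligibleP _ mna) a0.
have : diag E x setT = diag E x [set a].
  by rewrite -(setvU [set a]) measureU// ?setICl// a0 add0e.
rewrite diagT// diag_rnorm// => -[xE]; apply/esym/subr0_eq/(@ip0 _ _ ip).
(* The projection has the same norm as [x], so Pythagoras leaves nothing for the orthogonal part. *)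
have := dnormD ip (E [set a] x) (x - E [set a] x).
rewrite /= proj_orth// conjC0 !addr0 addrCA subrr addr0.
by rewrite [ip x x](ip_norm hip) xE -(ip_norm hip) -[LHS]addr0 => /addrI.
Qed.

End EigenOperator.
End EigenProjection.

(** * Eigenvectors under the functional calculus *)

(* The second clause says that [v] is also an eigenvector of the adjoint of [T],
   for the conjugate eigenvalue. *)
Definition reducing_eigenvector (R : realType) (H : completeNormedModType R[i])
    (ip : {dot H for Num.conj}) (T : H -> H) (v : H) :=
  exists al : R[i], forall x,
    ip (T v) x = al * ip v x /\ ip (T x) v = al * ip x v.

Section Calculus.
Context (R : realType) (H : completeNormedModType R[i]).
Variables (ip : {dot H for Num.conj}) (hip : norm_of_dot ip).
Variables (E : spectral_measure ip) (D : set (borelC R)).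
Hypotheses (mD : measurable D) (ED : forall x, E D x = x).
Variables (phi : borelC R -> borelC R) (T : {linear H -> H}).
Hypotheses (mphi : measurable_fun D phi)
  (ET : spectral_integral E D phi (total_operator T)).

(** The scalar measure of [w] is concentrated at [a], where the integrand equals [phi a]. *)
Lemma calculus_atom (a : R[i]) w : D a -> E [set a] w = w ->
  ip (T w) w = phi a * ip w w.
Proof.
move=> Da Qw; have ma := measurableC1 a; have mna := measurableC ma.
have w0 : diag E w (~` [set a]) = 0.
  rewrite (diag_rnorm hip E w mna) -Qw -projI// setICl.
  by rewrite (proj_set0 hip) rnorm0 expr0n.
case: ET => _ -> //; rewrite (ip_norm hip) /cintegral.
rewrite (@Rintegral_atom _ _ _ _ D mD a (fun z => complex.Re (phi z)))//; last first.
  exact: measurableT_comp (@measurable_Re R) mphi.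
rewrite (@Rintegral_atom _ _ _ _ D mD a (fun z => complex.Im (phi z)))//; last first.
  exact: measurableT_comp (@measurable_Im R) mphi.
rewrite (diag_support hip mD ED) /=; case: (phi a) => b c /=.
by apply/eqP; rewrite eq_complex /= !mulr0 subr0 add0r !eqxx.
Qed.

Lemma calculus_eigen (a : R[i]) v : v != 0 -> E [set a] v = v ->
  reducing_eigenvector ip T v.
Proof.
move=> v0 Qv; have ma := measurableC1 a.
(* Otherwise [v] would lie in the range of the projection of the empty set. *)
have Da : D a.
  apply: contra_notP (elimN eqP v0) => nDa.
  rewrite -(ED v) -Qv -projI// (_ : _ `&` _ = set0) ?(proj_set0 hip)//.
  by apply/seteqP; split=> // z [Dz /= az]; apply: nDa; rewrite -az.
(* The form of [T - phi a] vanishes on the diagonal of this range, so [polarization0] with K = 0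
   kills it off the diagonal. *)
have polar w w' : E [set a] w = w -> E [set a] w' = w' ->
    ip (T w) w' = phi a * ip w w'.
  move=> Qw Qw'.
  have [|/eqP + _] := @polarization0 _ 0 (ip (T w) w' - phi a * ip w w')
    (ip (T w') w - phi a * ip w' w); last by rewrite subr_eq0 => /eqP.
  move=> c _; have Qc : E [set a] (w + c *: w') = w + c *: w'.
    by rewrite linearD linearZ /= Qw Qw'.
  have Tc : T (w + c *: w') = T w + c *: T w' by rewrite linearD linearZ.
  have := calculus_atom Da Qc; rewrite Tc !dot_addZ.
  rewrite (calculus_atom Da Qw) (calculus_atom Da Qw') => /eqP.
  by rewrite -subr_eq0 => /eqP <-; ring.
have cross x : ip (T v) (x - E [set a] x) = 0 /\ ip (T (x - E [set a] x)) v = 0.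
  (* The two components of this [y] are [v] and [x - E [set a] x], so [proj_reduces] at [y] yields
     both cross terms. *)
  set y := v + (x - E [set a] x).
  have Qy : E [set a] y = v by rewrite linearD linearB/= proj_idem// subrr addr0.
  have := @proj_reduces _ _ _ hip _ _ _ _ ET [set a] y ma Logic.I.
  by rewrite /= Qy {1 2}/y [v + _]addrC addrK.
exists (phi a) => x; have [ol or] := cross x; split.
- rewrite -[x in LHS](subrK (E [set a] x)) linearDr/= ol add0r polar ?proj_idem//.
  by rewrite -proj_selfadjoint// Qv.
- rewrite -[x in LHS](subrK (E [set a] x)) linearD linearDl/= or add0r.
  by rewrite polar ?proj_idem// proj_selfadjoint// Qv.
Qed.

End Calculus.

Section FunctionalCalculus.
Context (R : realType) (H : completeNormedModType R[i]).
Variables (ip : {dot H for Num.conj}) (hip : norm_of_dot ip).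

(** Each calculus brings its own spectral measure; the conclusion no longer mentions it, so the
    results for [Rop] and [S] can be combined. *)
Lemma borel_calculus_eigen (L : operator H) (phi : borelC R -> borelC R)
    (T : {linear H -> H}) v :
  bounded_borel_symbol L phi -> borel_calculus ip L phi T ->
  eigenvector L v -> reducing_eigenvector ip T v.
Proof.
move=> [mphi _ _] [E [[ED EL] ET]] [v0 dv [a La]].
have mD : measurable (spectrum L : set (borelC R)).
  apply: measurableC; apply: open_measurableC; exact: open_resolvent_set.
apply: (calculus_eigen hip mD ED mphi ET v0).
exact: (eigen_proj hip mD ED EL dv La).
Qed.

(** The adjoint clause moves the eigenvalue out of the coefficient of [T x]; the other clause puts
    it back as [T (e j)]. *)
Lemma fourier_sum_commute (e : nat -> H) (T : {linear H -> H}) :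
  (forall j, reducing_eigenvector ip T (e j)) ->
  forall x n, T (fourier_sum ip e x n) = fourier_sum ip e (T x) n.
Proof.
move=> eT x n; rewrite linear_sum; apply: eq_bigr => j _.
have [al alE] := eT j; rewrite linearZ/= (alE x).2 mulrC -scalerA.
by congr (_ *: _); apply: (@ip_inj _ _ ip) => z; rewrite (alE z).1 linearZl_LR.
Qed.

End FunctionalCalculus.

(* Unconditional convergence in N and the error estimate *)
Local Close Scope complex_scope.

Theorem theorem6p5 (R : realType) (H : completeNormedModType R[i])
  (ip : {dot H for Num.conj}) (hip : norm_of_dot ip)
  (hsep : separable_space H) (hdim : infinite_dimensional H)
  (L : operator H) (hL : normal_operator ip L)
  (e : nat -> H) (he : orthonormal_basis ip e)
  (heL : forall j, eigenvector L (e j))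
  (P : nat -> H -> H) (hP : forall k, orth_projector ip (lin_span e k) (P k))
  (N : normedModType R[i]) (X : lmodType R[i])
  (iH : {linear H -> X}) (iN : {linear N -> X})
  (hiH : injective iH) (hiN : injective iN) :
  exists r : H -> nat -> R,
    (forall g,
       [/\ nonincreasing_seq (r g), forall k, 0 <= r g k <= 1 &
           r g @ \oo --> (0 : R)]) /\
    forall (omega eta : borelC R -> borelC R),
      bounded_borel_symbol L omega -> bounded_borel_symbol L eta ->
    forall Rop S : {linear H -> H},
      continuous Rop -> continuous S ->
      borel_calculus ip L omega Rop -> borel_calculus ip L eta S ->
    forall RN : {linear H -> N},
      continuous RN -> (forall x, iN (RN x) = iH (Rop x)) ->
    forall f g : H, f = Rop (S g) ->
      (forall s : nat -> nat, bijective s ->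
         converges_in iH iN (fourier_sum ip (e \o s) f) f) /\
      (forall k, (0 < k)%N ->
         exists y : N, iN y = iH (f - fourier_sum ip e f k) /\
           rnorm y <= opnorm RN * rnorm g * opnorm (fun x => S (x - P k x))
                      * r g k).
Proof.
pose F g k := fourier_sum ip e g k.
have one := he.1.
have F0 g : F g 0%N = 0 by rewrite /F /fourier_sum big_ord0.
have F_dist g k l : (k <= l)%N -> rnorm (g - F g l) <= rnorm (g - F g k).
  by move=> kl; rewrite -lecR -!rnormE; exact: fourier_sum_dist_nonincr.
(* For g = 0 the division by zero makes this sequence identically 0. *)
exists (fun g k => rnorm (g - F g k) / rnorm g); split=> [g|].
  split=> [k l kl|k|].
  - by rewrite ler_wpM2r ?invr_ge0 ?rnorm_ge0//; exact: F_dist.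
  - rewrite divr_ge0 ?rnorm_ge0//=; have [->|g0] := eqVneq (rnorm g) 0.
      by rewrite invr0 mulr0.
    rewrite ler_pdivrMr ?mul1r; last by rewrite lt_neqAle eq_sym g0 rnorm_ge0.
    by have := F_dist g 0%N k (leq0n k); rewrite F0 subr0.
  - rewrite -[X in _ --> X](mul0r (rnorm g)^-1); apply: cvgMl.
    apply/cvgrPdist_lt => eps eps0.
    have eps0C : 0 < (eps%:C)%C by rewrite ltcR.
    have /cvgrPdist_lt/(_ _ eps0C) := @fourier_cvg _ _ _ hip e g he.
    apply: filterS => n; rewrite sub0r normrN ger0_norm ?rnorm_ge0//.
    by rewrite rnormE ltcR.
move=> omega eta bomega beta Rop S _ Sc Romega Seta RN RNc iRN f g ->.
have eR j := borel_calculus_eigen hip bomega Romega (heL j).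
have eS j := borel_calculus_eigen hip beta Seta (heL j).
(* Stated for every [s]: permutations serve the convergence, the identity serves the estimate. *)
have RS_F (s : nat -> nat) x n : Rop (S (fourier_sum ip (e \o s) x n)) =
    fourier_sum ip (e \o s) (Rop (S x)) n.
  by rewrite !fourier_sum_commute// => j; [exact: eR|exact: eS].
split=> [s bs|k _].
  exists (fun n => RN (S (fourier_sum ip (e \o s) g n))), (RN (S g)).
  split=> [n||]; [by rewrite iRN RS_F|by rewrite iRN|].
  apply: continuous_cvg; first exact: RNc.
  apply: continuous_cvg; first exact: Sc.
  exact/fourier_cvg/orthonormal_basis_reindex.
set h := g - F g k.
exists (RN (S h)); split.
  by rewrite iRN /h !linearB/= -(RS_F id).
have PF x : P k x = F x k by exact: orth_projectorE (hP k).
(* Hence [S h] equals [S (h - P k h)], which brings in the norm of S(I - P_k). *)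
have Ph : P k h = 0.
  rewrite PF /F /fourier_sum big1// => j _.
  by rewrite /h linearBl/= ip_fourier_sum// subrr scale0r.
(* [P k] is a bare function; its linearity comes from the Fourier sum formula. *)
have SP_lin : linear (fun x => S (x - P k x)).
  move=> a x y; rewrite -linearP; congr (S _); rewrite !PF /F /fourier_sum.
  rewrite scalerBr scaler_sumr addrACA -opprD -big_split; congr (_ - _).
  by apply: eq_bigr => j _; rewrite linearPl/= scalerDl scalerA.
pose SP : {linear H -> H} := HB.pack (fun x => S (x - P k x))
  (GRing.isLinear.Build _ _ _ _ (fun x => S (x - P k x)) SP_lin).
have [M M0 SM] := continuous_rnorm_le Sc.
have [M' _ RNM] := continuous_rnorm_le RNc.
have SPM x : rnorm (SP x) <= M * rnorm x.
  rewrite (le_trans (SM _))// ler_wpM2l ?(ltW M0)// PF.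
  by have := F_dist x 0%N k (leq0n k); rewrite F0 subr0.
have := le_opnorm h SPM; rewrite /SP/= Ph subr0 => Sh.
rewrite (le_trans (le_opnorm _ RNM))// -!mulrA ler_wpM2l//.
  exact: opnorm_ge0 RNM.
rewrite (le_trans Sh)// mulrCA ler_wpM2l//.
  exact: opnorm_ge0 SPM.
(* If g = 0, the right-hand side is 0 and the norm of [h] is at most that of [g]. *)
have [g0|g0] := eqVneq (rnorm g) 0; last by rewrite mulrCA mulfV// mulr1.
by rewrite g0 mul0r -g0; have := F_dist g 0%N k (leq0n k); rewrite F0 subr0.
Qed.
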